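(* Let $E$ be a real Hilbert space, let $L>0$, and let $f:E\to\mathbb{R}$ be $L$-smooth. Suppose $x^*\in E$ satisfies $f(x^* )=\inf_{x\in E} f(x)$. Let $\alpha>0$, $x_0\in E$, and let $(x_k)_{k\ge 0}$ be the sequence generated by gradient descent with fixed step size $\alpha$, i.e. $x_{k+1}=x_k-\alpha\nabla f(x_k)$ for all $k\ge 0$. (1) If $f$ is convex and $0<\alpha\le \frac{1}{L}$, then for every integer $k\ge 1$, $$f(x_k)-f(x^* )\le \frac{1}{2\alpha k}\|x_0-x^*\|^2 .$$ (2) If $f$ is $m$-strongly convex for some $m>0$ and $0<\alpha\le\frac{2}{m+L}$, then for every integer $k\ge 0$, $$\|x_k-x^*\|^2\le\left(1-\alpha\frac{2mL}{m+L}\right)^k\|x_0-x^*\|^2 .$$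
   Context: $f$ is $L$-smooth if it is differentiable at every point of $E$ (with gradient $\nabla f(x)\in E$ representing the Fréchet derivative via the Riesz theorem) and $\|\nabla f(x)-\nabla f(y)\|\le L\|x-y\|$ for all $x,y\in E$. $f$ is $m$-strongly convex on $E$ if for all $x,y\in E$ and $a,b\ge 0$ with $a+b=1$, $f(ax+by)\le a f(x)+b f(y)-ab\,\frac{m}{2}\|x-y\|^2$. *)

(* Defs.v *)
From mathcomp Require Import all_boot all_order all_algebra sesquilinear.
From mathcomp Require Import all_classical all_reals all_analysis.

Set Implicit Arguments.
Unset Strict Implicit.
Unset Printing Implicit Defensive.

Import Order.TTheory GRing.Theory Num.Theory.
Import numFieldNormedType.Exports.

Local Open Scope classical_set_scope.
Local Open Scope ring_scope.

(* With [E] a [completeNormedModType], this makes [E] a real Hilbert space: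
   the norm (which induces the complete topology of [E]) is the one of the
   positive definite symmetric bilinear form [ip]. *)
Definition norm_of_inner (R : realType) (E : normedModType R)
    (ip : {dot E for idfun}) : Prop :=
  forall x : E, `|x| = Num.sqrt (ip x x).

(* The Riesz representative of the Frechet derivative ['d f x] ([get] is
   classical choice).  Where [f] is differentiable and [E] is Hilbert it exists
   and is unique by the Riesz theorem; elsewhere the value is irrelevant. *)
Definition gradient (R : realType) (E : normedModType R)
    (ip : {dot E for idfun}) (f : E -> R) (x : E) : E :=
  get (fun g : E => forall h : E, 'd f x h = ip g h).

Definition smooth (R : realType) (E : normedModType R)
    (ip : {dot E for idfun}) (L : R) (f : E -> R) : Prop :=
  (forall x : E, differentiable f x) /\
  (forall x y : E, `|gradient ip f x - gradient ip f y| <= L * `|x - y|).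

Definition strongly_convex (R : realType) (E : normedModType R)
    (m : R) (f : E -> R) : Prop :=
  forall (x y : E) (a b : R), 0 <= a -> 0 <= b -> a + b = 1 ->
    f (a *: x + b *: y) <=
      a * f x + b * f y - a * b * (m / 2) * `|x - y| ^+ 2.

(* Main.v *)
(* The gradient represents the derivative by the Riesz theorem, so L-smoothness
   gives |f (x + h) - f x - <g x, h>| <= L |h|^2 / 2, and m-strong convexity
   gives f y >= f x + <g x, y - x> + m |y - x|^2 / 2.

   For (1), smoothness gives the descent f x_{k+1} <= f x_k - alpha |g x_k|^2 / 2,
   which combined with convexity (the case m = 0) yields
   2 alpha (f x_{k+1} - f xstar) <= |x_k - xstar|^2 - |x_{k+1} - xstar|^2;
   this telescopes, and f x_k is nonincreasing.

   For (2), the two quadratic bounds give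
   (m + L) <g x, x - xstar> >= m L |x - xstar|^2 + |g x|^2,
   which bounds the cross term in the expansion of |x_{k+1} - xstar|^2. *)
Require Import Defs.
From mathcomp Require Import all_boot all_order all_algebra sesquilinear.
From mathcomp Require Import all_classical all_reals all_analysis.
From mathcomp Require Import ring lra.

Set Implicit Arguments.
Unset Strict Implicit.
Unset Printing Implicit Defensive.

Import Order.TTheory GRing.Theory Num.Theory.
Import numFieldNormedType.Exports.

Local Open Scope classical_set_scope.
Local Open Scope ring_scope.

(** * Inner product identities and the Cauchy-Schwarz inequality *)

Section RealInnerProduct.
Variables (R : realType) (E : normedModType R) (ip : {dot E for idfun}).
Implicit Types u v w : E.

Lemma ipC u v : ip u v = ip v u.
Proof. by rewrite hermC expr0 mul1r. Qed.

Lemma ipDl u v w : ip (u + v) w = ip u w + ip v w.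
Proof. exact: linearDl. Qed.

Lemma ipZl a u v : ip (a *: u) v = a * ip u v.
Proof. exact: linearZl_LR. Qed.

Lemma ipNl u v : ip (- u) v = - ip u v.
Proof. exact: linearNl. Qed.

Lemma ipDr u v w : ip u (v + w) = ip u v + ip u w.
Proof. by rewrite ipC ipDl !(ipC u). Qed.

Lemma ipZr a u v : ip u (a *: v) = a * ip u v.
Proof. by rewrite ipC ipZl (ipC u). Qed.

Lemma ipNr u v : ip u (- v) = - ip u v.
Proof. by rewrite ipC ipNl (ipC u). Qed.

Definition ipE := (ipDl, ipDr, ipZl, ipZr, ipNl, ipNr).

Lemma ip_ge0 u : 0 <= ip u u.
Proof.
have [->|u0] := eqVneq u 0; first by rewrite linear0r.
exact/ltW/neq0_dnorm_gt0.
Qed.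

Hypothesis Hip : norm_of_inner ip.

Lemma sqr_norm_ip u : `|u| ^+ 2 = ip u u.
Proof. by rewrite Hip sqr_sqrtr// ip_ge0. Qed.

(** Expanding the squared norm of [|v| u - |u| v] gives [2 |u| |v|] times the gap of the inequality;
    this factor can be cancelled once the zero vectors are set apart. *)
Lemma ip_le u v : ip u v <= `|u| * `|v|.
Proof.
have [->|u0] := eqVneq u 0.
  by rewrite normr0 mul0r -(scale0r u) ipZl mul0r.
have [->|v0] := eqVneq v 0.
  by rewrite normr0 mulr0 -(scale0r v) ipZr mul0r.
have {}u0 : 0 < `|u| by rewrite normr_gt0.
have {}v0 : 0 < `|v| by rewrite normr_gt0.
have := ip_ge0 (`|v| *: u - `|u| *: v).
rewrite !ipE (ipC v u) -!sqr_norm_ip => H.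
have : 0 <= (`|u| * `|v|) * (`|u| * `|v| - ip u v) by nra.
by rewrite pmulr_rge0 ?mulr_gt0// subr_ge0.
Qed.

End RealInnerProduct.

(** * The Riesz representation theorem *)

Section Riesz.
Variables (R : realType) (E : completeNormedModType R).
Variables (ip : {dot E for idfun}) (Hip : norm_of_inner ip).

(* The representative is the minimizer of [q v = `|v|^2 / 2 - l v]; minimizing
   sequences are Cauchy by the parallelogram identity. *)
Lemma riesz (l : {linear E -> R}) : continuous l ->
  exists g : E, forall h, l h = ip g h.
Proof.
move=> l_cont.
have [C C_gt0 lC] : exists2 C, 0 < C & forall v, `|l v| <= C * `|v|.
  have /linear_boundedP := iffRL (linear_bounded_continuous l) l_cont.
  by move=> /pinfty_ex_gt0 [C C0 lC]; exists C.
pose q v := `|v| ^+ 2 / 2 - l v.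
have q_lb v : - (C ^+ 2 / 2) <= q v.
  have := lC v; have := ler_norm (l v); rewrite /q => ? ?.
  have := sqr_ge0 (`|v| - C); nra.
have [i q_ge i_adh] : exists2 i : R, forall v, i <= q v &
    forall e, 0 < e -> exists v, q v < i + e.
  have q_inf : has_inf (range q).
    by split; [exists (q 0), 0|exists (- (C ^+ 2 / 2)) => _ [v _ <-]].
  exists (inf (range q)) => [v|e e0].
    by apply: ge_inf; [case: q_inf|exists v].
  by have [_ [v _ <-] ?] := inf_adherent e0 q_inf; exists v.
(* The linear terms cancel at the midpoint, where [q] is still at least [i]; so near-minimizers are
   close to each other. *)
have parallelogram u v : `|u - v| ^+ 2 = 4 * (q u + q v - 2 * q (2^-1 *: (u + v))).
  have lE : l (2^-1 *: (u + v)) = 2^-1 * (l u + l v) by rewrite linearZ linearD.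
  by rewrite /q lE !(sqr_norm_ip Hip) !ipE (ipC ip v u); field.
have [u qu] : {u : nat -> E & forall n, q (u n) < i + n.+1%:R^-1}.
  apply: (@boolp.choice _ _ (fun n v => q v < i + n.+1%:R^-1)) => n.
  by apply: i_adh; rewrite invr_gt0.
have inv_cvg : n.+1%:R^-1 @[n --> \oo] --> (0 : R) := cvg_harmonic.
have u_cauchy : cauchy (u @ \oo).
  apply: cauchy_exP => e e_gt0.
  (* Two values of [q] within [e ^+ 2 / 8] of [i] put their points at squared distance below
     [4 * (2 * (e ^+ 2 / 8)) = e ^+ 2]. *)
  have e8 : 0 < e ^+ 2 / 8 by rewrite divr_gt0// exprn_gt0.
  have [N _ small] : \forall n \near \oo, n.+1%:R^-1 < e ^+ 2 / 8.
    exact: cvgr_lt inv_cvg _ e8.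
  exists (u N), N => // n /small un; rewrite /= -ball_normE /=.
  rewrite -(@ltr_pXn2r _ 2) ?nnegrE ?normr_ge0 ?(ltW e_gt0)// parallelogram.
  have := q_ge (2^-1 *: (u N + u n)); have := qu N; have := qu n.
  have : N.+1%:R^-1 < e ^+ 2 / 8 by exact: small (leqnn N).
  move: un => /=; move: (q (u n)) (q (u N)) (q _) => a b c.
  move: n.+1%:R^-1 N.+1%:R^-1 (e ^+ 2) => r s ee; lra.
have [g ug] : exists g : E, u @ \oo --> g.
  have u_cvg : cvg (u @ \oo) by exact: (iffLR (cauchy_cvgP _) u_cauchy).
  by exists (lim (u @ \oo)).
have qg : q g <= i.
  have qu_cvg : q (u n) @[n --> \oo] --> q g.
    apply: cvgB; last by apply: continuous_cvg ug; exact: l_cont.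
    apply: cvgM; last exact: cvg_cst.
    by apply: cvgM; exact: cvg_norm.
  have i_cvg : i + n.+1%:R^-1 @[n --> \oo] --> i + 0.
    by apply: cvgD => //; exact: cvg_cst.
  rewrite -(addr0 i) -(cvg_lim _ qu_cvg)// -(cvg_lim _ i_cvg)//.
  apply: ler_lim; [exact: cvgP qu_cvg|exact: cvgP i_cvg|].
  by apply: nearW => n; exact: ltW.
exists g => h.
have [c c_def] : exists c, c = ip g h - l h by eexists.
suff : c = 0 by move=> c0; apply/eqP; rewrite eq_sym -subr_eq0 -c_def c0.
pose N := ip h h.
have N_ge0 : 0 <= N := ip_ge0 ip h.
(* Comparing [g] with [g - s *: h] gives [s * c <= s ^+ 2 * N / 2], which forces [s = 0] as
   [c = s * (N + 1)]. Dividing by [N + 1] rather than [N] covers [h = 0]. *)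
pose s := c / (N + 1).
have cE : c = s * (N + 1) by rewrite divfK// gt_eqF// ltr_wpDl.
have lE : l (g - s *: h) = l g - s * l h by rewrite linearB linearZ.
have := le_trans qg (q_ge (g - s *: h)).
rewrite /q lE !(sqr_norm_ip Hip) !ipE (ipC ip h g) -/N.
have -> : ip g h = c + l h by rewrite c_def subrK.
move=> H; have {}H : s * c <= s ^+ 2 * N / 2 by lra.
have /eqP : s ^+ 2 = 0.
  apply/eqP; rewrite eq_le sqr_ge0 andbT; move: H; rewrite cE.
  have := mulr_ge0 (sqr_ge0 s) N_ge0; lra.
by rewrite sqrf_eq0 cE => /eqP ->; rewrite mul0r.
Qed.

End Riesz.

(** * First-order Taylor bounds along a line *)

Lemma taylor1_le (R : realType) (p dp : R -> R) (K : R) :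
  (forall t : R, is_derive t 1 p (dp t)) ->
  (forall t, 0 <= t -> dp t - dp 0 <= K * t) ->
  p 1 - p 0 - dp 0 <= K / 2.
Proof.
move=> p_dp dpK.
(* The derivative of [r] is nonnegative on the unit interval by the bound on [dp], so monotonicity
   replaces integration. *)
pose r t := K / 2 * t ^+ 2 + dp 0 * t - p t.
have r_d (t : R) : is_derive t 1 r (K * t + dp 0 - dp t).
  rewrite /r; apply: is_derive_eq.
  by rewrite /GRing.scale/=; field.
suff : r 0 <= r 1 by rewrite /r expr0n expr1n /=; lra.
apply: (@ger0_derive1_ndecr R r 0 1) => //; [move=> t t01|].
- rewrite derive1E derive_val; have := dpK t; rewrite in_itv/= in t01.
  case/andP: t01 => t0 _ /(_ (ltW t0)); lra.
- apply: derivable_within_continuous => t _; by have [] := r_d t.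
Qed.

Lemma taylor1 (R : realType) (p dp : R -> R) (K : R) :
  (forall t : R, is_derive t 1 p (dp t)) ->
  (forall t, 0 <= t -> `|dp t - dp 0| <= K * t) ->
  `|p 1 - p 0 - dp 0| <= K / 2.
Proof.
move=> p_dp dpK; rewrite ler_norml; apply/andP; split; last first.
  by apply: taylor1_le => // t /dpK; rewrite ler_norml => /andP[].
have p_dpN (t : R) : is_derive t 1 (\- p) (- dp t) by exact: is_deriveN.
have dpKN t : 0 <= t -> - dp t - - dp 0 <= K * t.
  by move=> /dpK; rewrite ler_norml => /andP[]; lra.
have := taylor1_le p_dpN dpKN; rewrite /=; lra.
Qed.

Lemma is_derive_line (R : realType) (E : normedModType R) (f : E -> R)
    (x h : E) (t : R) :
  differentiable f (x + t *: h) ->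
  is_derive t 1 (fun s : R => f (x + s *: h)) ('d f (x + t *: h) h).
Proof.
move=> df.
have dl : is_diff t (fun s : R => x + s *: h) (fun s => s *: h).
  by have := is_diffD (is_diff_cst x t) (is_diff_scalel t h); rewrite add0r.
have [H1 H2] := is_diff_comp dl (differentiableP df).
apply: DeriveDef; first exact: diff_derivable.
by rewrite deriveE// H2 /= scale1r.
Qed.

(** * Quadratic bounds and coercivity of the gradient *)

Section Gradient.
Variables (R : realType) (E : completeNormedModType R).
Variables (ip : {dot E for idfun}) (Hip : norm_of_inner ip).
Implicit Types (f : E -> R) (x y h : E).

Lemma gradientP f x : differentiable f x ->
  forall h, 'd f x h = ip (gradient ip f x) h.
Proof.
move=> df; have [g gP] := riesz Hip (diff_continuous df).
by apply: (@xgetPex _ _ (fun g => forall h, 'd f x h = ip g h)); exists g.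
Qed.

(** On the segment from [x] to [x + h], Cauchy-Schwarz and the Lipschitz gradient bound the change
    of the directional derivative by [L * |h|^2 * t]. *)
Lemma smooth_taylor L f : smooth ip L f -> forall x h,
  `|f (x + h) - f x - ip (gradient ip f x) h| <= L / 2 * `|h| ^+ 2.
Proof.
move=> [f_diff f_lip] x h.
pose p (t : R) := f (x + t *: h).
pose dp t := ip (gradient ip f (x + t *: h)) h.
have p_dp (t : R) : is_derive t 1 p (dp t).
  by rewrite /dp -gradientP//; exact: is_derive_line.
have dpK (t : R) : 0 <= t -> `|dp t - dp 0| <= L * `|h| ^+ 2 * t.
  move=> t0; rewrite /dp scale0r addr0 -ipNl -ipDl.
  set d := _ - _.
  have -> : L * `|h| ^+ 2 * t = L * `|t *: h| * `|h|.
    by rewrite normrZ ger0_norm//; ring.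
  have d_le : `|d| <= L * `|t *: h|.
    by apply: le_trans (f_lip _ _) _; rewrite addrAC subrr add0r.
  apply: (@le_trans _ _ (`|d| * `|h|)); last exact: ler_wpM2r.
  by rewrite ler_norml ip_le// lerNl -ipNl -(normrN d) ip_le.
have := taylor1 p_dp dpK.
by rewrite /p /dp scale0r scale1r addr0 mulrAC.
Qed.

Lemma strongly_convex_minorant L m f : smooth ip L f -> strongly_convex m f ->
  forall x y,
  f x + ip (gradient ip f x) (y - x) + m / 2 * `|y - x| ^+ 2 <= f y.
Proof.
move=> f_smooth f_cvx x y.
set G := ip _ _; set D := `|y - x| ^+ 2.
(* [K] collects the [t ^+ 2] terms: [L / 2 * D] from smoothness and [m / 2 * D] from the product
   [t * (1 - t)]. *)
have [K KE] : exists K, K = (m + L) / 2 * D by eexists.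
(* Instead of passing to the limit in difference quotients, compare the
   second-order bounds on [f] between [x] and [y] and let [t] tend to [0]. *)
have approx t : 0 < t -> t <= 1 -> f x + G + m / 2 * D - f y <= t * K.
  move=> t0 t1.
  have := smooth_taylor f_smooth x (t *: (y - x)).
  rewrite ler_norml normrZ ipZr exprMn real_normK ?num_real// -/G -/D => /andP[lo _].
  have := f_cvx y x t (1 - t) (ltW t0) _ (subrKC _ _).
  have -> : t *: y + (1 - t) *: x = x + t *: (y - x).
    by rewrite scalerBl scale1r scalerBr addrCA addrA.
  rewrite -/D subr_ge0 => /(_ t1) up.
  rewrite -(ler_pM2l t0) KE; lra.
rewrite -subr_le0 leNgt; apply/negP => c_gt0.
set c := _ - f y in c_gt0 approx.
have K_gt0 : 0 < K by have := approx 1 ltr01 (lexx 1); rewrite mul1r; lra.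
(* If [c <= K], then [t = c / (2 * K)] is admissible and yields [c <= c / 2]; otherwise [t = 1]
   already contradicts [K < c]. *)
have [cK|Kc] := leP c K.
  have t0 : 0 < c / (2 * K) by rewrite divr_gt0// mulr_gt0.
  have := approx _ t0.
  rewrite ler_pdivrMr ?mulr_gt0//.
  have -> : c / (2 * K) * K = c / 2 by field; rewrite gt_eqF.
  lra.
by have := approx 1 ltr01 (lexx 1); rewrite mul1r leNgt Kc.
Qed.

(** A gradient step of size [1 / L] from [xs] would decrease [f] by at least [|g|^2 / (2 L)]. *)
Lemma gradient_minimizer L f xs : 0 < L -> smooth ip L f -> (forall x, f xs <= f x) ->
  gradient ip f xs = 0.
Proof.
move=> L0 f_smooth f_min; set g := gradient ip f xs.
have := smooth_taylor f_smooth xs (- L^-1 *: g).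
rewrite ler_norml !(sqr_norm_ip Hip) !ipE -/g => /andP[_].
have := f_min (xs + - L^-1 *: g); set N := ip g g => H1 H2.
have Li : 0 < L^-1 by rewrite invr_gt0.
have : N <= 0.
  have H3 : L / 2 * (- L^-1 * (- L^-1 * N)) = L^-1 * N / 2.
    by field; rewrite gt_eqF.
  rewrite -(pmulr_rle0 _ Li); lra.
rewrite /N -(sqr_norm_ip Hip) => N0.
apply/eqP; rewrite -normr_eq0 -sqrf_eq0; apply/eqP/le_anti.
by rewrite N0 sqr_ge0.
Qed.

(* At [z = xs + w] the strongly convex minorant of [f] at [x] lies below the
   quadratic majorant at [xs], and at [z = x - w] with the roles exchanged.
   Summing cancels [f x] and [f xs], and [w = (g - m d) / (L - m)] is optimal.
   If [L <= m] (possible only in degenerate spaces), [w = 0] and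
   [`|g| <= L `|d|] suffice. *)
Lemma gradient_coercive L m f xs : 0 < L -> 0 < m ->
  smooth ip L f -> strongly_convex m f ->
  (forall x, f xs <= f x) -> forall x,
  m * L * `|x - xs| ^+ 2 + `|gradient ip f x| ^+ 2 <=
    (m + L) * ip (gradient ip f x) (x - xs).
Proof.
move=> L0 m0 f_smooth f_cvx f_min x.
set g := gradient ip f x.
have xE : x = xs + (x - xs) by rewrite addrC subrK.
have gs0 := gradient_minimizer L0 f_smooth f_min.
have up u : f (xs + u) <= f xs + L / 2 * `|u| ^+ 2.
  have := smooth_taylor f_smooth xs u.
  by rewrite gs0 linear0l ler_norml => /andP[_]; lra.
have up' u : f (x + u) <= f x + ip g u + L / 2 * `|u| ^+ 2.
  by have := smooth_taylor f_smooth x u; rewrite ler_norml -/g => /andP[_]; lra.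
have lo u : f xs + m / 2 * `|u| ^+ 2 <= f (xs + u).
  have := strongly_convex_minorant f_smooth f_cvx xs (xs + u).
  by rewrite gs0 linear0l addr0 [xs + u - xs]addrAC subrr add0r.
have lo' u : f x + ip g u + m / 2 * `|u| ^+ 2 <= f (x + u).
  have := strongly_convex_minorant f_smooth f_cvx x (x + u).
  by rewrite [x + u - x]addrAC subrr add0r.
have g_le : ip g g <= L ^+ 2 * ip (x - xs) (x - xs).
  rewrite -!(sqr_norm_ip Hip) -exprMn lerXn2r// ?nnegrE ?mulr_ge0 ?(ltW L0)//.
  by have := f_smooth.2 x xs; rewrite gs0 subr0 -/g.
move: (x - xs) xE g_le => d xE g_le.
have below_xs w : f x + ip g (w - d) + m / 2 * `|w - d| ^+ 2 <= f xs + L / 2 * `|w| ^+ 2.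
  apply: le_trans (lo' _) (le_trans _ (up w)).
  by rewrite xE -addrA [d + _]addrC subrK.
have below_x w : f xs + m / 2 * `|w + d| ^+ 2 <= f x + ip g w + L / 2 * `|w| ^+ 2.
  apply: le_trans (lo _) (le_trans _ (up' w)).
  by rewrite xE -addrA [d + _]addrC.
have sum w : m * ip d d + 2 * ip (g - m *: d) w - (L - m) * ip w w <= ip g d.
  have := below_xs w; have := below_x (- w); rewrite !(sqr_norm_ip Hip) !ipE (ipC ip d w).
  lra.
rewrite !(sqr_norm_ip Hip).
have [mL|Lm] := ltP m L.
  have M0 : 0 < L - m by rewrite subr_gt0.
  have := sum ((L - m)^-1 *: (g - m *: d)).
  rewrite !ipE (ipC ip d g) => H.
  pose X := ip g g - 2 * m * ip g d + m ^+ 2 * ip d d.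
  have {}H : m * ip d d + (L - m)^-1 * X <= ip g d.
    apply: le_trans H; rewrite le_eqVlt /X; apply/orP; left; apply/eqP.
    by field; rewrite gt_eqF.
  move: H; rewrite -(ler_pM2l M0) mulrDr mulVKf ?gt_eqF// /X; lra.
(* Here [|g|^2 <= L^2 |d|^2 <= m^2 |d|^2], so the left side is at most [(m + L) m |d|^2]. *)
have := sum 0; rewrite !linear0r ?mulr0 subr0 addr0 => mono.
have d0 := ip_ge0 ip d.
have : (m + L) * (m * ip d d) <= (m + L) * ip g d by rewrite ler_pM2l// addr_gt0.
have : L ^+ 2 * ip d d <= m ^+ 2 * ip d d.
  by rewrite ler_wpM2r// ler_pXn2r// nnegrE ltW.
lra.
Qed.

End Gradient.

(** * Convergence rates of gradient descent *)

Lemma convex_strongly_convex0 (R : realType) (E : normedModType R) (f : E -> R) :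
  convex_function [set: E] f -> strongly_convex 0 f.
Proof.
move=> f_cvx x y a b a0 b0 ab.
have a1 : a <= 1 by rewrite -ab lerDl.
have bE : b = 1 - a by rewrite -ab addrAC subrr add0r.
rewrite mul0r mulr0 mul0r subr0 bE.
by apply: (f_cvx (Itv01 a0 a1) x y); rewrite in_setE.
Qed.

Theorem theorem7 (R : realType) (E : completeNormedModType R)
    (ip : {dot E for idfun}) (Hip : norm_of_inner ip)
    (L : R) (L_gt0 : 0 < L)
    (f : E -> R) (f_smooth : smooth ip L f)
    (xstar : E) (xstar_min : (f xstar)%:E = ereal_inf [set (f x)%:E | x in [set: E]])
    (alpha : R) (alpha_gt0 : 0 < alpha)
    (x : nat -> E)
    (x_gd : forall k : nat, x k.+1 = x k - alpha *: gradient ip f (x k)) :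
  (convex_function [set: E] f -> 0 < alpha <= 1 / L ->
    forall k : nat, (1 <= k)%N ->
      f (x k) - f xstar <= 1 / (2 * alpha * k%:R) * `|x 0%N - xstar| ^+ 2)
  /\
  (forall m : R, 0 < m -> strongly_convex m f -> 0 < alpha <= 2 / (m + L) ->
    forall k : nat,
      `|x k - xstar| ^+ 2 <=
        (1 - alpha * (2 * m * L / (m + L))) ^+ k * `|x 0%N - xstar| ^+ 2).
Proof.
have f_min y : f xstar <= f y.
  by rewrite -lee_fin xstar_min; apply: ereal_inf_lbound; exists y.
set g := gradient ip f in x_gd *.
have step k : `|x k.+1 - xstar| ^+ 2 =
    `|x k - xstar| ^+ 2 - 2 * alpha * ip (g (x k)) (x k - xstar)
      + alpha ^+ 2 * `|g (x k)| ^+ 2.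
  rewrite x_gd addrAC !(sqr_norm_ip Hip); move: (x k - xstar) => d.
  by rewrite !ipE (ipC ip d); ring.
split=> [f_cvx /andP[_ aL] k k_gt0|m m0 f_cvx /andP[_ amL] k].
  have {}aL : alpha * L <= 1 by move: aL; rewrite ler_pdivlMr.
  have {}f_cvx := convex_strongly_convex0 f_cvx.
  have descent j : f (x j.+1) <= f (x j) - alpha / 2 * `|g (x j)| ^+ 2.
    have := smooth_taylor Hip f_smooth (x j) (- (alpha *: g (x j))).
    rewrite ler_norml -x_gd !(sqr_norm_ip Hip) !ipE -/g => /andP[_].
    have := ip_ge0 ip (g (x j)); set N := ip _ _ => N0 H.
    have : alpha * L * (alpha * N) <= 1 * (alpha * N).
      by rewrite ler_wpM2r// mulr_ge0// ltW.
    lra.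
  (* Convexity bounds [f (x j) - f xstar] by the inner product in [step], and the decrease from
     [descent] matches the [alpha ^+ 2] term exactly. *)
  have gap j : 2 * alpha * (f (x j.+1) - f xstar) <=
      `|x j - xstar| ^+ 2 - `|x j.+1 - xstar| ^+ 2.
    have := strongly_convex_minorant Hip f_smooth f_cvx (x j) xstar.
    rewrite mul0r mul0r addr0 -(opprB (x j)) ipNr -/g => lo.
    have : 2 * alpha * (f (x j.+1) - f xstar) <=
      2 * alpha * (ip (g (x j)) (x j - xstar) - alpha / 2 * `|g (x j)| ^+ 2).
      rewrite ler_pM2l ?mulr_gt0//; have := descent j; lra.
    rewrite step; lra.
  (* Monotonicity of [f (x n)] is built into the induction, so no sum of gaps appears. *)
  have telescope n : 2 * alpha * n%:R * (f (x n) - f xstar) <=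
      `|x 0%N - xstar| ^+ 2 - `|x n - xstar| ^+ 2.
    elim: n => [|n IH]; first by rewrite mulr0 mul0r subrr.
    have : 2 * alpha * n%:R * (f (x n.+1) - f xstar) <=
        2 * alpha * n%:R * (f (x n) - f xstar).
      rewrite ler_wpM2l ?mulr_ge0 ?(ltW alpha_gt0)// lerD2r.
      apply: le_trans (descent n) _.
      by rewrite gerBl mulr_ge0 ?sqr_ge0// divr_ge0// ltW.
    have := gap n; rewrite -natr1; lra.
  rewrite div1r mulrC ler_pdivlMr ?mulr_gt0 ?ltr0n// mulrC.
  by apply: le_trans (telescope k) _; rewrite gerBl sqr_ge0.
have mL0 : 0 < m + L by rewrite addr_gt0.
elim: k => [|k IH]; first by rewrite expr0 mul1r.
set q := 1 - _ in IH *.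
(* This follows from [alpha * (m + L) <= 2] and [4 m L <= (m + L)^2]; it allows multiplying [IH] by
   [q]. *)
have q0 : 0 <= q.
  rewrite /q subr_ge0; move: amL; rewrite ler_pdivlMr// => amL.
  rewrite mulrA ler_pdivrMr// mul1r.
  have : alpha * (m + L) * (2 * m * L) <= 2 * (2 * m * L).
    by rewrite ler_wpM2r// !mulr_ge0// ltW.
  have := sqr_ge0 (m - L) => ? ?.
  rewrite -(ler_pM2r mL0); lra.
rewrite (exprS q) -mulrA; apply: le_trans (ler_wpM2l q0 IH).
rewrite step -(ler_pM2l mL0).
have co := gradient_coercive Hip L_gt0 m0 f_smooth f_cvx f_min (x k); rewrite -/g in co.
set D := `|x k - xstar| ^+ 2 in co *; set G := `|g (x k)| ^+ 2 in co *.
set P := ip _ _ in co *.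
have -> : (m + L) * (q * D) = (m + L) * D - 2 * alpha * m * L * D.
  by rewrite /q; field; rewrite gt_eqF.
have {}co : 2 * alpha * (m * L * D + G) <= 2 * alpha * ((m + L) * P).
  by rewrite ler_pM2l// mulr_gt0.
(* The step size bound lets the [G] term of [co] absorb the squared gradient in [step]. *)
have : alpha * (m + L) * (alpha * G) <= 2 * (alpha * G).
  rewrite ler_wpM2r ?mulr_ge0 ?sqr_ge0 ?(ltW alpha_gt0)//.
  by move: amL; rewrite ler_pdivlMr.
lra.
Qed.
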